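(* The algebra $\mathbb{I}_1$ is a left and right coherent algebra.
   Context: $K$ is a field of characteristic zero. $\mathbb{I}_1$ is the subalgebra of $\mathrm{End}_K(K[x])$ generated by (multiplication by) $x$, $\partial=\frac{d}{dx}$ and $\int: x^n\mapsto \frac{x^{n+1}}{n+1}$. A finitely generated module is coherent if each of its finitely generated submodules is finitely presented; a ring $R$ is left (resp. right) coherent if the module ${}_RR$ (resp. $R_R$) is coherent. *)

(* Defs.v *)
From HB Require Import structures.
From mathcomp Require Import all_boot all_algebra.
From mathcomp Require Import boolp.

Set Implicit Arguments.
Unset Strict Implicit.
Unset Printing Implicit Defensive.

Import GRing.Theory.
Local Open Scope ring_scope.

Section Coherence.
Variable R : pzRingType.

Definition fin_gen (M : lmodType R) (N : {pred M}) : Prop :=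
  exists (n : nat) (g : 'I_n -> M), forall x : M,
    x \in N <-> exists a : 'I_n -> R, x = \sum_(i < n) a i *: g i.

(* [N] is the image of some R^n -> M with finitely generated kernel. *)
Definition fin_pres (M : lmodType R) (N : {pred M}) : Prop :=
  exists (n : nat) (phi : {linear 'rV[R]_n -> M}),
    (forall x : M, x \in N <-> exists a : 'rV[R]_n, x = phi a)
    /\ fin_gen [pred a : 'rV[R]_n | phi a == 0].

Definition coherent (M : lmodType R) : Prop :=
  fin_gen (@predT M) /\
  forall N : {pred M}, submod_closed N -> fin_gen N -> fin_pres N.

End Coherence.

Definition left_coherent (R : pzRingType) : Prop := coherent (R^o : lmodType R).

(* Right R-modules are left modules over the converse ring [R^c]; in
   particular [R^c^o] is the right regular module. *)
Definition right_coherent (R : pzRingType) : Prop :=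
  coherent (R^c^o : lmodType R^c).

Record polyEnd (K : fieldType) : Type :=
  PolyEnd { polyEnd_lin :> {linear {poly K} -> {poly K}} }.

Section PolyEnd.
Variable K : fieldType.
Implicit Types f g h : polyEnd K.

HB.instance Definition _ := gen_eqMixin (polyEnd K).
HB.instance Definition _ := gen_choiceMixin (polyEnd K).

Lemma polyEndP f g : f =1 g -> f = g.
Proof.
case: f => -[f [[Mf] [Sf]]]; case: g => -[g [[Mg] [Sg]]] /= /funext fg; subst g.
by rewrite (Prop_irrelevance Mf Mg) (Prop_irrelevance Sf Sg).
Qed.

Definition polyEnd_zero : polyEnd K := PolyEnd \0.
Definition polyEnd_opp f : polyEnd K := PolyEnd (\- f).
Definition polyEnd_add f g : polyEnd K := PolyEnd (f \+ g).
Definition polyEnd_one : polyEnd K := PolyEnd idfun.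
Definition polyEnd_mul f g : polyEnd K := PolyEnd (f \o g).
Definition polyEnd_scale (c : K) f : polyEnd K := PolyEnd (c \*: f).

Fact polyEnd_addA : associative polyEnd_add.
Proof. by move=> f g h; apply: polyEndP => p /=; rewrite addrA. Qed.
Fact polyEnd_addC : commutative polyEnd_add.
Proof. by move=> f g; apply: polyEndP => p /=; rewrite addrC. Qed.
Fact polyEnd_add0 : left_id polyEnd_zero polyEnd_add.
Proof. by move=> f; apply: polyEndP => p /=; rewrite add0r. Qed.
Fact polyEnd_addN : left_inverse polyEnd_zero polyEnd_opp polyEnd_add.
Proof. by move=> f; apply: polyEndP => p /=; rewrite addNr. Qed.

HB.instance Definition _ := GRing.isZmodule.Build (polyEnd K)
  polyEnd_addA polyEnd_addC polyEnd_add0 polyEnd_addN.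

Fact polyEnd_mulA : associative polyEnd_mul.
Proof. by move=> f g h; apply: polyEndP. Qed.
Fact polyEnd_mul1 : left_id polyEnd_one polyEnd_mul.
Proof. by move=> f; apply: polyEndP. Qed.
Fact polyEnd_mulr1 : right_id polyEnd_one polyEnd_mul.
Proof. by move=> f; apply: polyEndP. Qed.
Fact polyEnd_mulDl : left_distributive polyEnd_mul polyEnd_add.
Proof. by move=> f g h; apply: polyEndP. Qed.
Fact polyEnd_mulDr : right_distributive polyEnd_mul polyEnd_add.
Proof. by move=> f g h; apply: polyEndP => p /=; rewrite linearD. Qed.
Fact polyEnd_1neq0 : polyEnd_one != polyEnd_zero.
Proof.
apply/eqP => /(congr1 (fun f : polyEnd K => f 1)) /= /eqP.
by rewrite oner_eq0.
Qed.

HB.instance Definition _ := GRing.Zmodule_isNzRing.Build (polyEnd K)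
  polyEnd_mulA polyEnd_mul1 polyEnd_mulr1 polyEnd_mulDl polyEnd_mulDr
  polyEnd_1neq0.

Fact polyEnd_scaleA c d f :
  polyEnd_scale c (polyEnd_scale d f) = polyEnd_scale (c * d) f.
Proof. by apply: polyEndP => p /=; rewrite scalerA. Qed.
Fact polyEnd_scale1 : left_id 1 polyEnd_scale.
Proof. by move=> f; apply: polyEndP => p /=; rewrite scale1r. Qed.
Fact polyEnd_scaleDr : right_distributive polyEnd_scale +%R.
Proof. by move=> c f g; apply: polyEndP => p /=; rewrite scalerDr. Qed.
Fact polyEnd_scaleDl f : {morph polyEnd_scale^~ f : c d / c + d}.
Proof. by move=> c d; apply: polyEndP => p /=; rewrite scalerDl. Qed.

HB.instance Definition _ := GRing.Zmodule_isLmodule.Build K (polyEnd K)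
  polyEnd_scaleA polyEnd_scale1 polyEnd_scaleDr polyEnd_scaleDl.

Fact polyEnd_scaleAl (c : K) f g : c *: (f * g) = c *: f * g.
Proof. exact: polyEndP. Qed.
HB.instance Definition _ :=
  GRing.Lmodule_isLalgebra.Build K (polyEnd K) polyEnd_scaleAl.

Fact polyEnd_scaleAr (c : K) f g : c *: (f * g) = f * (c *: g).
Proof. by apply: polyEndP => p /=; rewrite linearZ. Qed.
HB.instance Definition _ :=
  GRing.Lalgebra_isAlgebra.Build K (polyEnd K) polyEnd_scaleAr.

End PolyEnd.

(* The primitive of [p] without constant term. *)
Definition poly_int (K : fieldType) (p : {poly K}) : {poly K} :=
  \sum_(i < size p) (p`_i / i.+1%:R) *: 'X^(i.+1).

Section Generators.
Variable K : fieldType.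

Lemma coef_poly_int (p : {poly K}) j :
  (poly_int p)`_j = if j is i.+1 then p`_i / i.+1%:R else 0.
Proof.
rewrite /poly_int coef_sum; case: j => [|j].
  by apply: big1 => i _; rewrite coefZ coefXn mulr0.
case: (ltnP j (size p)) => [ltj | lej].
  rewrite (bigD1 (Ordinal ltj)) //= coefZ coefXn eqxx mulr1 big1 ?addr0 //.
  by move=> i; rewrite -val_eqE eq_sym /= => /negbTE ne; rewrite coefZ coefXn eqSS ne mulr0.
rewrite nth_default // mul0r big1 // => i _.
by rewrite coefZ coefXn eqSS gtn_eqF ?mulr0 // (leq_trans (ltn_ord i)).
Qed.

Fact poly_int_is_linear : linear (@poly_int K).
Proof.
move=> c p q; apply/polyP=> -[|j]; rewrite coefD coefZ !coef_poly_int.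
  by rewrite mulr0 addr0.
by rewrite coefD coefZ mulrDl mulrA.
Qed.
HB.instance Definition _ :=
  GRing.isLinear.Build K {poly K} {poly K} *:%R (@poly_int K)
    poly_int_is_linear.

Lemma poly_int_Xn n : poly_int 'X^n = n.+1%:R^-1 *: 'X^(n.+1) :> {poly K}.
Proof.
apply/polyP=> -[|j]; rewrite coef_poly_int coefZ !coefXn ?mulr0 //.
rewrite eqSS; case: eqP => [->|_]; by rewrite ?mul1r ?mulr1 // mul0r mulr0.
Qed.

Definition endX : polyEnd K := PolyEnd ('X \*o idfun).
Definition endD : polyEnd K := PolyEnd (@deriv K).
Definition endInt : polyEnd K := PolyEnd (@poly_int K).

End Generators.

(* The smallest unital subalgebra containing [G]. *)
Definition gen_subalg (K : fieldType) (A : algType K) (G : seq A) : {pred A} :=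
  fun a => `[< forall S : {pred A},
                 subalg_closed S -> {subset G <= S} -> a \in S >].

Section GenSubalg.
Variables (K : fieldType) (A : algType K) (G : seq A).

Lemma gen_subalg_closed : subalg_closed (gen_subalg G).
Proof.
split=> [|c a b /asboolP Sa /asboolP Sb|a b /asboolP Sa /asboolP Sb];
  apply/asboolP => S clS GS; have [S1 SL SM] := clS => //.
- by apply: SL; [apply: Sa | apply: Sb].
- by apply: SM; [apply: Sa | apply: Sb].
Qed.

Lemma sub_gen_subalg : {subset G <= gen_subalg G}.
Proof. by move=> a Ga; apply/asboolP => S _; apply. Qed.

HB.instance Definition _ :=
  GRing.isSubalgClosed.Build K A (gen_subalg G)
    (GRing.subalg_closed_semi gen_subalg_closed).

End GenSubalg.

Record I1 (K : fieldType) : Type := InI1 {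
  I1val :> polyEnd K;
  _ : I1val \in gen_subalg [:: endX K; endD K; endInt K]
}.

Section I1.
Variable K : fieldType.

HB.instance Definition _ := [isSub for @I1val K].
HB.instance Definition _ := [Choice of I1 K by <:].
HB.instance Definition _ := [SubChoice_isSubAlgebra of I1 K by <:].

End I1.

(* Main.v *)
Require Import Defs.
From HB Require Import structures.
From mathcomp Require Import all_boot all_algebra.
From mathcomp Require Import boolp zify ring.
Set Implicit Arguments.
Unset Strict Implicit.
Unset Printing Implicit Defensive.
Import GRing.Theory.
Local Open Scope ring_scope.

(** The algebra R = I_1 acts faithfully on V = K[x].  Let D, I be d/dx and
    integration, and H = D x, so that H x^n = (n+1) x^n, D I = 1, x = I H and
    H I = I (H + 1).

    Coherence on either side follows once the solutions of one linear equation
    sum_i g_i a_i = 0 (or sum_i a_i g_i = 0) over R form a finitely generated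
    module ([left_coherent_syzygies], [right_coherent_syzygies]).  Only
    solutions on the right need work: R has an involutive anti-automorphism
    exchanging D and I and fixing H ([star]), the adjoint for the pairing on V
    in which the x^i are orthogonal of squared norm i!^2, and it swaps the two
    sides.  By induction on the number of unknowns, the equations are solved as
    soon as (J : g) = {a | g a in J} is a finitely generated right ideal for
    every g and every finitely generated right ideal J
    ([right_syzygies_of_colon], [fg_right_colon]).

    Every a in R satisfies a I^m = sum_j A_j(H) I^j for some m and some
    polynomials A_j ([normal_formP]).  Since A_j(H) is diagonal and I raises
    degrees by one, reading off the top degree shows that a either has finite
    rank, which amounts to a I^m = 0 for some m, or shifts the degree of every
    polynomial of large degree by a constant ([fredholm_index]).  In the second
    case a has finite-dimensional kernel and cokernel on V; moreover the
    elements of finite rank form a completely prime ideal F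
    ([not_finrankM]).

    The key point is that a right ideal L containing an element c outside F is
    finitely generated ([fg_right_not_finrank]).  The sums of A_j(H) I^j behave
    like polynomials in two variables for leading exponents, so Dickson's lemma
    yields finitely many elements of L generating all sums of this form in L
    ([nf_noetherian]).  They also generate a I^m D^m for each a in L and large
    m, and what is left, a (1 - I^m D^m), is controlled by the vectors l(1),
    l in L: modulo the image of c these lie in a finite-dimensional space.

    It follows that R satisfies the Ore condition modulo F ([ore_condition]):
    the right ideal generated by all h^k g is finitely generated, which gives a
    relation between finitely many of the h^k g, and factors h can be cancelled
    modulo F.  Finally (J : g) contains an element outside F when g is in F
    (some I^m), and also when neither g nor all of J is in F (by the Ore
    condition).  In the remaining case J is in F and g is not; then the vectors
    l(1), l in (J : g), have bounded degree because g has finite-dimensional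
    kernel, and (J : g) is again finitely generated. *)

(** * Finitely generated right ideals *)

Section RightIdeals.
Variable T : nzRingType.
Implicit Types (L : T -> Prop) (s t : seq T) (a b c : T).

Definition right_ideal L :=
  [/\ L 0, forall a b, L a -> L b -> L (a + b) & forall a c, L a -> L (a * c)].

Lemma ridealB L a b : right_ideal L -> L a -> L b -> L (a - b).
Proof. by move=> [_ LD LM] La Lb; rewrite -[b]mulr1 -mulrN; apply/LD/LM. Qed.

(** Defined by recursion on the generators of the ideal, so that they can be
    eliminated one at a time. *)
Fixpoint rspan s a : Prop :=
  if s is b :: s' then exists c, rspan s' (a - b * c) else a = 0.

Lemma rspan_ideal s : right_ideal (rspan s).
Proof.
elim: s => [|b s [IH0 IHD IHM]] /=.
  by split=> // [a b -> ->|a c ->]; rewrite ?addr0 ?mul0r.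
split=> [|a a' [c ac] [c' ac']|a r [c ac]].
- by exists 0; rewrite mulr0 subr0.
- by exists (c + c'); rewrite mulrDr opprD addrACA; apply: IHD.
- by exists (c * r); rewrite mulrA -mulrBl; apply: IHM.
Qed.

Lemma mem_rspan s b : b \in s -> rspan s b.
Proof.
elim: s => //= a s IHs; have [s0 _ _] := rspan_ideal s.
rewrite inE => /predU1P[->|bs]; first by exists 1; rewrite mulr1 subrr.
by exists 0; rewrite mulr0 subr0; apply: IHs.
Qed.

Lemma rspan_min L s a : right_ideal L -> (forall b, b \in s -> L b) ->
  rspan s a -> L a.
Proof.
move=> [L0 LD LM]; elim: s a => [|b s IHs] a /= Ls; first by move->.
case=> c /IHs Lac; rewrite -[a](subrK (b * c)); apply: LD; last first.
  by apply/LM/Ls; rewrite mem_head.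
by apply: Lac => d ds; apply: Ls; rewrite inE ds orbT.
Qed.

Lemma sub_rspan s t a : {subset s <= t} -> rspan s a -> rspan t a.
Proof. by move=> st; apply: rspan_min (rspan_ideal t) _ => b /st/mem_rspan. Qed.

Definition fg_right L := exists s, forall a, L a <-> rspan s a.

Lemma fg_rightI L s : right_ideal L -> (forall b, b \in s -> L b) ->
  (forall a, L a -> rspan s a) -> fg_right L.
Proof.
by move=> idL Ls Ls'; exists s => a; split; [apply: Ls' | apply: rspan_min].
Qed.
End RightIdeals.

(** * Dickson's lemma in two variables *)

Section Dickson.

(** Each row below [n] needs one generator only, its least exponent. *)
Lemma dickson_strip (P : nat -> nat -> Prop) n :
  exists2 s : seq (nat * nat), (forall x, x \in s -> P x.1 x.2) &
  forall i j, (i < n)%N -> P i j ->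
    exists2 x, x \in s & (x.1 <= i)%N && (x.2 <= j)%N.
Proof.
elim: n => [|n [s sP Ps]]; first by exists [::].
pose p j := `[< P n j >].
have [exp|noP] := pselect (exists j, p j); last first.
  exists s => // i j; rewrite ltnS leq_eqVlt => /predU1P[->|lt_in] Pij;
    last exact: Ps.
  by case: noP; exists j; apply/asboolP.
have [j0] := ex_minnP exp; move=> /asboolP Pj0 min_j0.
exists ((n, j0) :: s) => [x|i j].
  by rewrite inE => /predU1P[->|/sP].
rewrite ltnS leq_eqVlt => /predU1P[->|lt_in] Pij.
  by exists (n, j0); rewrite ?mem_head //= leqnn min_j0 //; apply/asboolP.
by have [x xs le_x] := Ps i j lt_in Pij; exists x => //; rewrite inE xs orbT.
Qed.

(** Outside the quadrant above one exponent [(i0, j0)] of [P] only finitely many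
    rows and columns remain. *)
Lemma dickson (P : nat -> nat -> Prop) :
  exists2 s : seq (nat * nat), (forall x, x \in s -> P x.1 x.2) &
  forall i j, P i j -> exists2 x, x \in s & (x.1 <= i)%N && (x.2 <= j)%N.
Proof.
have [[[i0 j0] /= P0]|noP] := pselect (exists x : nat * nat, P x.1 x.2);
  last first.
  by exists [::] => // i j Pij; case: noP; exists (i, j).
have [s sP Ps] := dickson_strip P i0.
have [t tP Pt] := dickson_strip (fun j i => P i j) j0.
pose swap (x : nat * nat) := (x.2, x.1).
exists ((i0, j0) :: s ++ [seq swap x | x <- t]) => [x|i j Pij].
  by rewrite inE mem_cat => /or3P[/eqP->|/sP|/mapP[y /tP ty ->]].
have [lt_i|le_i] := ltnP i i0.
  have [x xs le_x] := Ps i j lt_i Pij.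
  by exists x; rewrite // inE mem_cat xs orbT.
have [lt_j|le_j] := ltnP j j0.
  have [x xt le_x] := Pt j i lt_j Pij; exists (swap x); last by rewrite andbC.
  by rewrite inE mem_cat (map_f swap xt) !orbT.
by exists (i0, j0); rewrite ?mem_head //= le_i.
Qed.
End Dickson.

(** * Coherence and linear equations *)

Section Syzygies.

Definition left_syzygies_fg (T : nzRingType) :=
  forall n (g : 'cV[T]_n), exists k (b : 'M[T]_(k, n)),
    forall a : 'rV[T]_n, a *m g = 0 <-> exists c : 'rV[T]_k, a = c *m b.

Definition right_syzygies_fg (T : nzRingType) :=
  forall n (g : 'rV[T]_n), exists k (b : 'M[T]_(n, k)),
    forall a : 'cV[T]_n, g *m a = 0 <-> exists c : 'cV[T]_k, a = b *m c.

Lemma rspanP (T : nzRingType) (s : seq T) (a : T) :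
  rspan s a <->
  exists c : 'cV[T]_(size s), a%:M = (\row_(i < size s) s`_i) *m c.
Proof.
split=> [|[c /matrixP/(_ 0 0)]]; last first.
  rewrite !mxE eqxx mulr1n => ->; have [s0 sD sM] := rspan_ideal s.
  apply: (big_ind (rspan s)) => // i _; rewrite mxE; apply: sM.
  exact/mem_rspan/mem_nth.
elim: s a => [|b s IHs] a /=.
  by move->; exists 0; rewrite mulmx0 raddf0.
case=> r /IHs[c eq_c]; exists (col_mx r%:M c).
have -> : \row_(i < (size s).+1) (b :: s)`_i =
    row_mx b%:M (\row_(i < size s) s`_i) :> 'rV_(1 + size s).
  apply/rowP => i; rewrite !mxE; case: splitP => j ->; rewrite ?mxE //.
  by rewrite !ord1 eqxx mulr1n.
have e := mul_row_col b%:M (\row_(i < size s) s`_i) r%:M c.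
apply: (etrans _ (esym e)).
by rewrite -eq_c -scalar_mxM -raddfD /= addrC subrK.
Qed.

Lemma fg_right_mulmx (T : nzRingType) n (g : 'rV[T]_n) :
  let J x := exists a, x%:M = g *m a in right_ideal J /\ fg_right J.
Proof.
move=> J; have idJ : right_ideal J.
  split=> [|x y [a xa] [b yb]|x y [a xa]].
  - by exists 0; rewrite mulmx0 raddf0.
  - by exists (a + b); rewrite mulmxDr -xa -yb raddfD.
  - by exists (a *m y%:M); rewrite mulmxA -xa scalar_mxM.
split=> //; apply: (fg_rightI (s := [seq g 0 i | i <- enum 'I_n])) => //.
  move=> _ /mapP[i _ ->]; exists (delta_mx i 0).
  by rewrite -colE; apply/matrixP => j k; rewrite !ord1 !mxE mulr1n.
move=> x [a /matrixP/(_ 0 0)]; set s := map _ _.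
rewrite !mxE mulr1n => ->; have [s0 sD sM] := rspan_ideal s.
apply: (big_ind (rspan s)) => // i _; apply: sM.
by apply/mem_rspan/map_f; rewrite mem_enum.
Qed.

(** The first coordinates of the solutions of [g0 a0 + g' a' = 0] form the right
    ideal (J : g0), where J is generated by the entries of [g']; the solutions
    with [a0 = 0] are the syzygies of [g'].  Lifting generators of the former
    and adding those of the latter generates all solutions. *)
Lemma right_syzygies_of_colon (T : nzRingType) :
    (forall (J : T -> Prop) (g : T), right_ideal J -> fg_right J ->
       fg_right (fun a => J (g * a))) ->
  right_syzygies_fg T.
Proof.
move=> colon; elim=> [|n IHn] g.
  exists 0%N, 0 => a; rewrite [a]flatmx0 mulmx0.
  by split=> // _; exists 0; rewrite mulmx0.
rewrite -[n.+1]add1n in g *.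
rewrite -[g]hsubmxK; move: (lsubmx g) (rsubmx g) => g0 g'.
have [k [b bP]] := IHn g'.
have [idJ fgJ] := fg_right_mulmx g'.
have [s sP] := colon _ (g0 0 0) idJ fgJ.
have [f fP] : exists f : 'I_(size s) -> 'cV[T]_n,
    forall i : 'I_(size s), (g0 0 0 * s`_i)%:M = g' *m f i.
  suff: forall i : 'I_(size s), exists a, (g0 0 0 * s`_i)%:M = g' *m a.
    by case/choice=> f fP; exists f.
  by move=> i; apply/sP/mem_rspan/mem_nth.
pose l := \row_(i < size s) s`_i; pose F := \matrix_(j < n, i < size s) f i j 0.
have g0l : g0 *m l = g' *m F.
  apply/rowP => i; have /matrixP/(_ 0 0) := fP i.
  rewrite !mxE mulr1n big_ord1 mxE => ->; by apply: eq_bigr => j _; rewrite mxE.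
(* The columns of [F] lift the generators [l] of (J : g0) to solutions; those
   of [b] are the solutions whose first coordinate vanishes. *)
exists (size s + k)%N, (block_mx l 0 (- F) b) => a.
rewrite -[a]vsubmxK mul_row_col; move: (usubmx a) (dsubmx a) => a0 a'.
split=> [ga0|[c]].
  have a0E : a0 = (a0 0 0)%:M by apply/rowP => i; rewrite !ord1 mxE mulr1n.
  have /sP/rspanP[c eq_c] : exists x, (g0 0 0 * a0 0 0)%:M = g' *m x.
    exists (- a'); rewrite mulmxN; apply/eqP; rewrite -addr_eq0 -ga0.
    by apply/eqP; congr (_ + _); apply/rowP => i; rewrite !ord1 !mxE big_ord1.
  have /bP[d eq_d] : g' *m (a' + F *m c) = 0.
    by rewrite mulmxDr mulmxA -g0l -mulmxA -eq_c -a0E addrC.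
  exists (col_mx c d); rewrite mul_block_col mul0mx addr0 -eq_c -a0E mulNmx.
  by rewrite -eq_d addrCA addNr addr0.
rewrite -[c]vsubmxK mul_block_col mul0mx addr0 => /eq_col_mx[-> ->].
have /bP g'b : exists d, b *m dsubmx c = b *m d by exists (dsubmx c).
by rewrite mulmxDr g'b addr0 mulNmx mulmxN !mulmxA g0l subrr.
Qed.

Section AntiIsomorphism.
Variables (T S : nzRingType) (phi : {additive T -> S}) (psi : S -> T).
Hypotheses (phiM : forall x y, phi (x * y) = phi y * phi x).
Hypotheses (psiK : cancel psi phi) (phiK : cancel phi psi).

Lemma map_anti_mulmx m n p (A : 'M[T]_(m, n)) (B : 'M[T]_(n, p)) :
  (map_mx phi (A *m B))^T = (map_mx phi B)^T *m (map_mx phi A)^T.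
Proof.
apply/matrixP => i j; rewrite !mxE raddf_sum.
by apply: eq_bigr => k _; rewrite !mxE phiM.
Qed.

(** Applying an anti-isomorphism entrywise and transposing turns the equation
    [a *m g = 0] into an equation with the unknown on the right. *)
Lemma left_syzygies_anti : right_syzygies_fg T -> left_syzygies_fg S.
Proof.
pose star m n (A : 'M[T]_(m, n)) := (map_mx phi A)^T.
pose unstar m n (A : 'M[S]_(m, n)) := (map_mx psi A)^T.
have unstarK m n (A : 'M[S]_(m, n)) : star _ _ (unstar _ _ A) = A.
  by apply/matrixP => i j; rewrite !mxE psiK.
have starK m n (A : 'M[T]_(m, n)) : unstar _ _ (star _ _ A) = A.
  by apply/matrixP => i j; rewrite !mxE phiK.
have starM m n p (A : 'M[T]_(m, n)) (B : 'M[T]_(n, p)) :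
  star _ _ (A *m B) = star _ _ B *m star _ _ A := map_anti_mulmx A B.
have star0 m n : star m n 0 = 0 by apply/matrixP => i j; rewrite !mxE raddf0.
move=> syz n g; have [k [b bP]] := syz n (unstar _ _ g).
exists k, (star _ _ b) => a; split=> [ag0|[c ->]].
  have /bP[c eq_c] : unstar _ _ g *m unstar _ _ a = 0.
    by apply: (can_inj (starK _ _)); rewrite starM !unstarK ag0 star0.
  by exists (star _ _ c); rewrite -starM -eq_c unstarK.
have /bP gb0 : exists d, b *m unstar _ _ c = b *m d by exists (unstar _ _ c).
by rewrite -[c]unstarK -starM -[g]unstarK -starM gb0 star0.
Qed.
End AntiIsomorphism.

Section Coherence.
Variable T : nzRingType.

Definition lincomb n (g : 'cV[T]_n) (a : 'rV[T]_n) : T^o := (a *m g) 0 0.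

Fact lincomb_linear n (g : 'cV[T]_n) : linear (lincomb g).
Proof.
move=> k a b; rewrite /lincomb mulmxDl -scalemxAl.
suff entry (A B : 'M[T]_1) : (k *: A + B) 0 0 = k * A 0 0 + B 0 0.
  exact: entry.
by rewrite !mxE.
Qed.
HB.instance Definition _ n (g : 'cV[T]_n) :=
  GRing.isLinear.Build T 'rV[T]_n T^o *:%R (lincomb g) (lincomb_linear g).

Lemma lincombE n (g : 'I_n -> T^o) (a : 'rV[T]_n) :
  lincomb (\col_i g i) a = \sum_(i < n) a 0 i *: g i.
Proof.
have entry : (a *m \col_i g i) 0 0 = \sum_(i < n) a 0 i * g i.
  by rewrite mxE; apply: eq_bigr => i _; rewrite mxE.
exact: entry.
Qed.

(** Generators of an ideal N present it as the image of a free module, and the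
    kernel of this presentation is the module of syzygies of the generators. *)
Lemma left_coherent_syzygies : left_syzygies_fg T -> left_coherent T.
Proof.
move=> syz; split.
  exists 1%N, (fun=> 1) => x; split=> // _; exists (fun=> x).
  by rewrite big_ord1 [_ *: _]mulr1.
move=> N _ [n [g gP]]; pose G := \col_i (g i : T).
exists n, (lincomb G); split.
  move=> x; rewrite gP; split=> [[a ->]|[a ->]]; last first.
    by exists (a 0); apply: lincombE.
  exists (\row_i a i); apply: etrans (esym (lincombE g _)).
  by apply: eq_bigr => i _; rewrite mxE.
have [k [b bP]] := syz n G; exists k, (fun i => row i b) => a.
have -> : (a \in [pred a | lincomb G a == 0]) <-> a *m G = 0.
  rewrite inE /lincomb; split=> [/eqP aG0|->]; last by rewrite mxE.
  by apply/matrixP => i j; rewrite !ord1 aG0 mxE.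
rewrite bP; split=> [[c ->]|[c ->]].
  by exists (c 0); rewrite mulmx_sum_row.
exists (\row_i c i); rewrite mulmx_sum_row.
by apply: eq_bigr => i _; rewrite mxE.
Qed.
End Coherence.

Lemma right_coherent_syzygies (T : nzRingType) :
  right_syzygies_fg T -> right_coherent T.
Proof.
move=> syz; apply: (@left_coherent_syzygies T^c).
exact: (@left_syzygies_anti T T^c idfun idfun).
Qed.
End Syzygies.
(** * The algebra of integro-differential operators *)

Section IntegroDifferential.
Variable K : fieldType.
Local Notation R := (I1 K).
Implicit Types p q : {poly K}.

Fact gen_I1 (f : polyEnd K) : f \in [:: endX K; endD K; endInt K] ->
  f \in gen_subalg [:: endX K; endD K; endInt K].
Proof. exact: sub_gen_subalg. Qed.

Fact mem_endX : endX K \in [:: endX K; endD K; endInt K].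
Proof. by rewrite !inE eqxx. Qed.
Fact mem_endD : endD K \in [:: endX K; endD K; endInt K].
Proof. by rewrite !inE eqxx orbT. Qed.
Fact mem_endInt : endInt K \in [:: endX K; endD K; endInt K].
Proof. by rewrite !inE eqxx !orbT. Qed.

Definition mulx : R := InI1 (gen_I1 mem_endX).
Definition diff : R := InI1 (gen_I1 mem_endD).
Definition prim : R := InI1 (gen_I1 mem_endInt).
(** Locked: otherwise rewriting with ring laws sees through it to the product. *)
Definition eulerH : R := locked (diff * mulx).

Lemma I1P (a b : R) : a =1 b -> a = b.
Proof. by move=> ab; apply/val_inj/polyEndP. Qed.

Lemma I1_add (a b : R) p : (a + b) p = a p + b p. Proof. by []. Qed.
Lemma I1_sub (a b : R) p : (a - b) p = a p - b p. Proof. by []. Qed.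
Lemma I1_mul (a b : R) p : (a * b) p = a (b p). Proof. by []. Qed.
Lemma I1_scale k (a : R) p : (k *: a) p = k *: a p. Proof. by []. Qed.
Lemma I1_one p : (1 : R) p = p. Proof. by []. Qed.
Lemma mulxE p : mulx p = 'X * p. Proof. by []. Qed.
Lemma diffE p : diff p = p^`(). Proof. by []. Qed.

Lemma coef_prim p n : (prim p)`_n.+1 = p`_n / n.+1%:R.
Proof. exact: (coef_poly_int _ n.+1). Qed.

Lemma coef0_prim p : (prim p)`_0 = 0.
Proof. exact: (coef_poly_int _ 0). Qed.

(** The elements satisfying [P] form a subalgebra containing the generators, and
    [I1] is the smallest such. *)
Lemma I1_ind (P : R -> Prop) :
    P 1 -> (forall k a b, P a -> P b -> P (k *: a + b)) ->
    (forall a b, P a -> P b -> P (a * b)) ->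
    P mulx -> P diff -> P prim -> forall a, P a.
Proof.
move=> P1 Plin Pmul Px Pd Pi a.
pose S : {pred polyEnd K} := fun f => `[< exists2 b : R, val b = f & P b >].
suff /asboolP[b eq_ba Pb] : val a \in S by rewrite -(val_inj eq_ba).
have /asboolP := valP a; apply.
  split=> [|k f g /asboolP[b <- Pb] /asboolP[c <- Pc]
           |f g /asboolP[b <- Pb] /asboolP[c <- Pc]]; apply/asboolP.
  - by exists 1.
  - by exists (k *: b + c) => //; apply: Plin.
  - by exists (b * c) => //; apply: Pmul.
move=> f; rewrite !inE => /or3P[] /eqP->; apply/asboolP.
- by exists mulx.
- by exists diff.
- by exists prim.
Qed.

Hypothesis charK0 : [pchar K] =i pred0.

Let natK_neq0 n : n.+1%:R != 0 :> K.
Proof. by rewrite ((pcharf0P K).1 charK0). Qed.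

Lemma diff_prim : diff * prim = 1.
Proof.
apply: I1P => p; apply/polyP => n.
by rewrite I1_mul diffE coef_deriv coef_prim I1_one -[LHS]mulr_natr divfK.
Qed.

Lemma coef_eulerH p n : (eulerH p)`_n = n.+1%:R * p`_n.
Proof.
by rewrite /eulerH -lock I1_mul mulxE diffE coef_deriv coefXM /= mulr_natl.
Qed.

Lemma prim_eulerH : prim * eulerH = mulx.
Proof.
apply: I1P => p; apply/polyP => -[|n]; rewrite I1_mul mulxE coefXM /=.
  exact: coef0_prim.
by rewrite coef_prim coef_eulerH mulrC mulKf.
Qed.

Lemma eulerH_prim : eulerH * prim = prim * (eulerH + 1).
Proof.
apply: I1P => p; apply/polyP => -[|n].
  by rewrite coef_eulerH !coef0_prim mulr0.
rewrite coef_eulerH !coef_prim I1_add coefD coef_eulerH I1_one.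
by rewrite -natr1; field; rewrite nat1r.
Qed.

Local Notation evalH := (horner_alg eulerH).

Lemma coef_evalH p q n : (evalH p q)`_n = p.[n.+1%:R] * q`_n.
Proof.
elim/poly_ind: p q => [|p c IHp] q; first by rewrite rmorph0 horner0 coef0 mul0r.
rewrite rmorphD rmorphM /= horner_algX horner_algC. rewrite coefD !hornerE.
by rewrite IHp coef_eulerH I1_scale I1_one coefZ mulrDl mulrA.
Qed.

Lemma evalH_prim p : exists q, evalH p * prim = prim * evalH q.
Proof.
elim/poly_ind: p => [|p c [q eq_q]]; first by exists 0; rewrite rmorph0 mul0r mulr0.
exists (q * ('X + 1) + c%:P).
rewrite !(rmorphD, rmorphM, rmorph1) /= !horner_algX !horner_algC mulrDl -mulrA.
rewrite eulerH_prim mulrA eq_q [RHS]mulrDr [prim * (_ * _)]mulrA.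
by congr (_ + _); apply: I1P => r; rewrite !(I1_mul, I1_scale, I1_one) linearZ.
Qed.

(** The operator sum_j A_j(H) I^j, where I is integration and A_j is the
    coefficient of [A] at ['X^j].  Only the additive structure of
    [{poly {poly K}}] is compatible with composition of operators. *)
Definition normal_form (A : {poly {poly K}}) : R := (map_poly evalH A).[prim].
Local Notation nf := normal_form.

Fact normal_form_additive : zmod_morphism nf.
Proof. by move=> A B; rewrite /nf rmorphB /= hornerD hornerN. Qed.
HB.instance Definition _ :=
  GRing.isZmodMorphism.Build {poly {poly K}} R nf normal_form_additive.

Lemma nf_scale (k : K) A : nf (k%:P *: A) = k *: nf A.
Proof.
rewrite /nf -mul_polyC rmorphM /= map_polyC /= hornerCM horner_algC.
by rewrite -scalerAl mul1r.
Qed.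

Lemma nfC c : nf c%:P = evalH c.
Proof. by rewrite /nf map_polyC hornerC. Qed.

Lemma nfMX A : nf (A * 'X) = nf A * prim.
Proof. by rewrite /nf rmorphM /= map_polyX hornerMX. Qed.

(** Right multiplication by H in normal form: since I^j H = (H - j) I^j, the
    coefficient A_j becomes A_j (X - j), and the correction sum_j j A_j Y^j is
    [A^`() * 'X]. *)
Definition twistH (A : {poly {poly K}}) :=
  locked (A * 'X%:P - A^`() * 'X).

Lemma nf_twistH A : nf (twistH A) = nf A * eulerH.
Proof.
have primH : prim * eulerH = eulerH * prim - prim.
  by rewrite eulerH_prim mulrDr mulr1 addrK.
elim/poly_ind: A => [|A c IHA].
  by rewrite /twistH -!lock derivC !mul0r subr0 !raddf0 mul0r.
have -> : twistH (A * 'X + c%:P) = (twistH A - A) * 'X + (c * 'X)%:P.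
  rewrite /twistH -!lock derivD derivC addr0 derivM derivX mulr1 polyCM.
  ring.
rewrite raddfD /= nfMX nfC raddfB /= IHA raddfD /= nfMX nfC rmorphM /= horner_algX.
by rewrite [RHS]mulrDl -[nf A * prim * _]mulrA primH mulrBr !mulrA mulrBl.
Qed.


Lemma nfMXn A m : nf (A * 'X^m) = nf A * prim ^+ m.
Proof.
elim: m => [|m IHm]; first by rewrite !expr0 !mulr1.
by rewrite !exprSr !mulrA nfMX IHm.
Qed.

Lemma nf_mulH A c : exists B, nf A * evalH c = nf B.
Proof.
elim/poly_ind: c => [|c k [B eq_B]]; first by exists 0; rewrite rmorph0 mulr0 raddf0.
exists (twistH B + k%:P *: A).
rewrite !raddfD /= nf_twistH nf_scale -eq_B rmorphM /= horner_algX horner_algC.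
rewrite [LHS]mulrDr mulrA; congr (_ + _); apply: I1P => p.
by rewrite !(I1_mul, I1_scale, I1_one) linearZ.
Qed.

Lemma nf_mul A B : exists C, nf A * nf B = nf C.
Proof.
elim/poly_ind: B => [|B c [C eq_C]]; first by exists 0; rewrite !raddf0 mulr0.
have [D eq_D] := nf_mulH A c; exists (C * 'X + D).
by rewrite !raddfD /= !nfMX nfC -eq_C -eq_D [LHS]mulrDr mulrA.
Qed.

(** Integration can be moved across a normal form, because A(H) I = I A(H + 1).
    This is what makes the set of [a] with a normal form after multiplication by
    a power of I stable under products. *)
Lemma nf_prim A m : exists B, nf A * prim ^+ m = prim ^+ m * nf B.
Proof.
suff nf_prim1 C : exists B, nf C * prim = prim * nf B.
  elim: m => [|m [B eq_B]]; first by exists A; rewrite expr0 mul1r mulr1.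
  have [C eq_C] := nf_prim1 B; exists C.
  by rewrite exprSr mulrA eq_B -mulrA eq_C mulrA.
elim/poly_ind: C => [|C c [B eq_B]]; first by exists 0; rewrite !raddf0 mul0r mulr0.
have [d eq_d] := evalH_prim c; exists (B * 'X + d%:P).
rewrite !raddfD /= !nfMX !nfC [LHS]mulrDl [RHS]mulrDr; congr (_ + _) => //.
by rewrite mulrA -eq_B.
Qed.

(** The powers of integration serve as common denominators: D itself is not a
    normal form, but D I = 1 is. *)
Lemma normal_formP a : exists m A, a * prim ^+ m = nf A.
Proof.
have nfX : nf 'X = prim by rewrite -['X]mul1r nfMX nfC rmorph1 mul1r.
elim/I1_ind: a => [|k a b [m [A eqA]] [n [B eqB]]|a b [m [A eqA]] [n [B eqB]]|||].
- by exists 0%N, 1; rewrite nfC rmorph1 mulr1.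
- exists (m + n)%N, (k%:P *: (A * 'X^n) + B * 'X^m).
  rewrite raddfD /= nf_scale !nfMXn -eqA -eqB [LHS]mulrDl -!mulrA -!exprD.
  by rewrite [in prim ^+ (n + m)]addnC scalerAl.
- have [C eqC] := nf_prim B m; have [D eqD] := nf_mul A C.
  exists (n + m)%N, D.
  by rewrite exprD mulrA -[a * b * _]mulrA eqB -mulrA eqC mulrA eqA.
- by exists 0%N, (twistH 'X); rewrite nf_twistH nfX prim_eulerH mulr1.
- by exists 1%N, 1; rewrite expr1 diff_prim nfC rmorph1.
- by exists 0%N, 'X; rewrite nfX mulr1.
Qed.

(** * Degrees and elements of finite rank *)

Lemma size_prim p : p != 0 -> size (prim p) = (size p).+1.
Proof.
move=> p_neq0; apply/eqP; rewrite eqn_leq; apply/andP; split.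
  apply/leq_sizeP => -[|j] // lt_j; rewrite coef_prim nth_default ?mul0r //.
rewrite ltnNge; apply/negP => /leq_sizeP/(_ (size p))/(_ (leqnn _)) /eqP.
rewrite -(prednK (_ : 0 < size p)%N) ?lt0n ?size_poly_eq0 // coef_prim.
rewrite mulf_eq0 invr_eq0 (negPf (natK_neq0 _)) orbF -lead_coefE.
by rewrite lead_coef_eq0 (negPf p_neq0).
Qed.

Lemma size_primX m p : p != 0 -> size ((prim ^+ m) p) = (size p + m)%N.
Proof.
move=> p_neq0; elim: m => [|m IHm]; first by rewrite addn0.
rewrite exprS I1_mul size_prim ?IHm ?addnS //.
by rewrite -size_poly_eq0 IHm addn_eq0 size_poly_eq0 (negPf p_neq0).
Qed.

Lemma size_evalH_le c q : (size (evalH c q) <= size q)%N.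
Proof. by apply/leq_sizeP => j le_j; rewrite coef_evalH nth_default ?mulr0. Qed.

Lemma size_evalH c (q : {poly K}) :
  c.[(size q)%:R] != 0 -> size (evalH c q) = size q.
Proof.
have [->|q_neq0] := eqVneq q 0; first by rewrite raddf0.
move=> cq_neq0; apply/eqP; rewrite eqn_leq size_evalH_le /= leqNgt; apply/negP.
have sz_q : (0 < size q)%N by rewrite lt0n size_poly_eq0.
rewrite -(prednK sz_q) ltnS => /leq_sizeP/(_ (size q).-1 (leqnn _)) /eqP.
rewrite coef_evalH prednK // mulf_eq0 (negPf cq_neq0) -lead_coefE.
by rewrite lead_coef_eq0 (negPf q_neq0).
Qed.

(** Integration raises the degree by exactly one and A_j(H) multiplies x^n by
    A_j(n + 1), so the top term comes from the leading coefficient of [A] alone,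
    unless its value at the relevant integer vanishes. *)
Lemma size_nf A (q : {poly K}) : A != 0 -> q != 0 ->
    (lead_coef A).[(size q + (size A).-1)%:R] != 0 ->
  size (nf A q) = (size q + (size A).-1)%N.
Proof.
elim/poly_ind: A q => [|A c IHA] q; first by rewrite eqxx.
have [->|A_neq0 _ q_neq0] := eqVneq A 0.
  rewrite mul0r add0r lead_coefC size_polyC polyC_eq0 => c_neq0 q_neq0.
  by rewrite c_neq0 /= addn0 nfC; apply: size_evalH.
have szA : (0 < size A)%N by rewrite lt0n size_poly_eq0.
have ltA : (size c%:P < size (A * 'X)%R)%N.
  by rewrite size_mulX // ltnS (leq_trans (size_polyC_leq1 _)).
rewrite size_polyDl // lead_coefDl // lead_coefMX size_mulX //=.
rewrite [nf (_ + _)]raddfD /= nfMX nfC => lead_neq0.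
have sz1 : size (prim q) = (size q).+1 by apply: size_prim.
have eq1 : (size q + size A = size (prim q) + (size A).-1)%N by lia.
have prq_neq0 : prim q != 0 by rewrite -size_poly_eq0 sz1.
rewrite eq1 size_polyDl ?IHA // -eq1 //.
by rewrite (leq_ltn_trans (size_evalH_le _ _)) //; lia.
Qed.

(** In characteristic zero distinct naturals are distinct elements of [K], and
    a nonzero polynomial has finitely many roots. *)
Lemma natr_root_bounded (p : {poly K}) : p != 0 ->
  exists N, forall n, (N <= n)%N -> p.[n%:R] != 0.
Proof.
have [s] := ubnP (size p); elim: s p => // s IHs p lt_ps p_neq0.
have [[n root_n]|no_root] := pselect (exists n, root p n%:R); last first.
  by exists 0%N => n _; apply/negP => root_n; apply: no_root; exists n.
have [q def_p] := factor_theorem p n%:R root_n.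
have q_neq0 : q != 0 by apply: contra_neq p_neq0 => q0; rewrite def_p q0 mul0r.
have [|N qN] := IHs q _ q_neq0.
  by move: lt_ps; rewrite def_p size_mul ?polyXsubC_eq0 // size_XsubC addn2.
exists (maxn N n.+1) => m; rewrite geq_max => /andP[leNm lt_nm].
rewrite def_p hornerM mulf_neq0 ?qN // hornerXsubC -natrB 1?ltnW //.
by rewrite ((pcharf0P K).1 charK0) -lt0n subn_gt0.
Qed.

Lemma size_image_bounded (a : R) m :
  exists B, forall q : {poly K}, (size q <= m)%N -> (size (a q) <= B)%N.
Proof.
elim: m => [|m [B leB]].
  by exists 0%N => q; rewrite leqn0 size_poly_eq0 => /eqP->; rewrite raddf0 size_poly0.
exists (maxn B (size (a 'X^m))) => q le_qm.
have -> : q = take_poly m q + q`_m *: 'X^m.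
  apply/polyP => i; rewrite coefD coef_take_poly coefZ coefXn.
  case: ltngtP => [lt_im|lt_mi|->]; rewrite ?mulr0 ?mulr1 ?add0r ?addr0 //.
  by rewrite nth_default // (leq_trans le_qm).
rewrite linearD linearZ /= (leq_trans (size_polyD _ _)) // geq_max !leq_max.
apply/andP; split; first by rewrite leB ?size_take_poly.
by rewrite size_scale_leq orbT.
Qed.

(** I^m D^m is the projection of V that kills the polynomials of degree below
    [m] and fixes ['X^n] for [n >= m]. *)
Lemma primX_diffX m (q : {poly K}) :
  (size (q - (prim ^+ m) ((diff ^+ m) q))%R <= m)%N.
Proof.
elim: m => [|m IHm]; first by rewrite !expr0 !I1_one subrr size_poly0.
set p := (diff ^+ m) q in IHm *.
have -> : (prim ^+ m.+1) ((diff ^+ m.+1) q) =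
    (prim ^+ m) p - (prim ^+ m) (p`_0)%:P.
  rewrite exprSr exprS !I1_mul -raddfB; congr ((prim ^+ m) _).
  apply/polyP => -[|i]; rewrite coefB coefC /= ?coef0_prim ?subrr //.
  rewrite coef_prim coef_deriv subr0 -[_ *+ i.+1]mulr_natr mulfK //.
rewrite opprB addrA addrAC (leq_trans (size_polyD _ _)) // geq_max (leq_trans IHm) //=.
have [->|c_neq0] := eqVneq (p`_0) 0; first by rewrite raddf0 size_poly0.
by rewrite size_primX ?polyC_eq0 // size_polyC c_neq0.
Qed.

(** Bounded degree of the image amounts to finite rank, as V is the union of its
    finite-dimensional subspaces of bounded degree. *)
Definition finrank (a : R) :=
  exists B, forall q : {poly K}, (size (a q) <= B)%N.

(** Up to a polynomial of degree below [m], on which [a] is bounded, the argument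
    is I^m of its m-th derivative, and there [a] acts through its normal form. *)
Lemma size_nf_index a m A : a * prim ^+ m = nf A -> A != 0 ->
  exists N, forall q : {poly K}, (N <= size q)%N ->
    (size (a q) + m = size q + (size A).-1)%N.
Proof.
move=> eq_aA A_neq0.
have [B leB] := size_image_bounded a m.
have [|N leadN] := @natr_root_bounded (lead_coef A).
  by rewrite lead_coef_eq0.
(* N keeps the leading value nonzero, m makes the derivative nonzero, and B
   keeps the remainder below the top term. *)
exists (N + B + m).+1 => q leNq.
pose q' := (diff ^+ m) q; pose r := q - (prim ^+ m) q'.
have le_rm : (size r <= m)%N := primX_diffX m q.
have def_q : q = (prim ^+ m) q' + r by rewrite addrC subrK.
have q'_neq0 : q' != 0.
  by apply: contraTneq leNq => q'0; rewrite def_q q'0 raddf0 add0r -ltnNge; lia.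
have szq : (size q = size q' + m)%N.
  have sz_q'm := size_primX m q'_neq0.
  rewrite {1}def_q size_polyDl sz_q'm // (leq_ltn_trans le_rm) //.
  by rewrite -[X in (X < _)%N]add0n ltn_add2r lt0n size_poly_eq0.
have sz_aq' : (size (nf A q') = size q' + (size A).-1)%N.
  by rewrite size_nf // leadN //; lia.
have aE : a ((prim ^+ m) q') = nf A q' by rewrite -[LHS]I1_mul eq_aA.
rewrite {1}def_q linearD /= aE size_polyDl sz_aq'; first by rewrite szq addnAC.
rewrite (leq_ltn_trans (leB r le_rm)) //; move: leNq; rewrite szq; lia.
Qed.

(** A normal form with bounded image vanishes, by the index formula. *)
Lemma finrankP a : finrank a <-> exists m, a * prim ^+ m = 0.
Proof.
split=> [[B leB]|[m a0]].
  have [m [A eqA]] := normal_formP a; exists m; rewrite eqA.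
  have [->|A_neq0] := eqVneq A 0; first by rewrite raddf0.
  have [N szN] := size_nf_index eqA A_neq0.
  have := szN 'X^(N + B + m); have := leB 'X^(N + B + m).
  by rewrite size_polyXn; lia.
have [B leB] := size_image_bounded a m; exists B => q.
have aE p : a ((prim ^+ m) p) = 0 by rewrite -[LHS]I1_mul a0.
rewrite -[q](subrK ((prim ^+ m) ((diff ^+ m) q))) linearD /= aE addr0.
exact/leB/primX_diffX.
Qed.

(** An element of infinite rank shifts all large degrees by the constant
    [J - m], which is minus its Fredholm index.  Hence its kernel and its
    cokernel on V are finite-dimensional. *)
Lemma fredholm_index a : ~ finrank a ->
  exists N m J, forall q : {poly K}, (N <= size q)%N ->
    (size (a q) + m = size q + J)%N.
Proof.
move=> a_inf; have [m [A eqA]] := normal_formP a.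
have A_neq0 : A != 0.
  apply: contra_notN a_inf => /eqP A0; apply/finrankP; exists m.
  by rewrite eqA A0 raddf0.
by have [N szN] := size_nf_index eqA A_neq0; exists N, m, (size A).-1.
Qed.

(** Two degree shifts compose to a degree shift, so the image stays unbounded. *)
Lemma not_finrankM a b : ~ finrank a -> ~ finrank b -> ~ finrank (a * b).
Proof.
move=> /fredholm_index[N [m [J szN]]] /fredholm_index[N' [m' [J' szN']]].
move=> [B leB].
pose q : {poly K} := 'X^(N + N' + m + m' + B).
have := leB q; rewrite I1_mul; have := szN' q; have := szN (b q).
by rewrite size_polyXn; lia.
Qed.

Lemma not_finrank_primX m : ~ finrank (prim ^+ m).
Proof.
move=> [B leB]; have := leB 'X^B; rewrite size_primX; last first.
  by rewrite -size_poly_eq0 size_polyXn.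
by rewrite size_polyXn; lia.
Qed.

(** * Right ideals containing an element of infinite rank *)

Lemma size_cancel_lead (p q : {poly K}) : p != 0 -> size p = size q ->
  (size (p - (lead_coef p / lead_coef q) *: q)%R < size p)%N.
Proof.
move=> p_neq0 eq_sz; have szp : (0 < size p)%N by rewrite lt0n size_poly_eq0.
have q_neq0 : q != 0 by rewrite -size_poly_eq0 -eq_sz size_poly_eq0.
rewrite -[in X in (_ < X)%N](prednK szp) ltnS; apply/leq_sizeP => j.
rewrite coefB coefZ leq_eqVlt => /predU1P[<-|]; last first.
  by rewrite prednK // => lepj; rewrite !nth_default -?eq_sz // mulr0 subrr.
by rewrite [in q`_ _]eq_sz -!lead_coefE divfK ?subrr // lead_coef_eq0.
Qed.

Lemma coef_twistH (A : {poly {poly K}}) k : (twistH A)`_k = A`_k * ('X - k%:R).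
Proof.
rewrite /twistH -lock coefB coefMC coefMX coef_deriv.
case: k => [|k] /=; first by rewrite mulr0n !subr0.
by rewrite mulrBr mulr_natr.
Qed.

Lemma size_twistH (A : {poly {poly K}}) : size (twistH A) = size A.
Proof.
have linN0 k : 'X - k%:R != 0 :> {poly K} by rewrite -polyC_natr polyXsubC_eq0.
have [->|A_neq0] := eqVneq A 0.
  suff -> : twistH (0 : {poly {poly K}}) = 0 by [].
  by apply/polyP => k; rewrite coef_twistH coef0 mul0r.
apply/eqP; rewrite eqn_leq; apply/andP; split.
  by apply/leq_sizeP => k lek; rewrite coef_twistH nth_default ?mul0r.
have szA : (0 < size A)%N by rewrite lt0n size_poly_eq0.
rewrite -[in X in (X <= _)%N](prednK szA) ltnNge.
apply/negP => /leq_sizeP/(_ _ (leqnn _))/eqP.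
rewrite coef_twistH mulf_eq0 (negPf (linN0 _)) -lead_coefE.
by rewrite lead_coef_eq0 (negPf A_neq0).
Qed.

Lemma size_lead_twistH (A : {poly {poly K}}) : A != 0 ->
  size (lead_coef (twistH A)) = (size (lead_coef A)).+1.
Proof.
move=> A_neq0; rewrite [in LHS]lead_coefE size_twistH coef_twistH -lead_coefE.
rewrite -polyC_natr size_mul ?polyXsubC_eq0 ?lead_coef_eq0 //.
by rewrite size_XsubC addn2.
Qed.

(** Right multiplication by H raises the degree of the leading coefficient by
    one, and by integration the degree in I: the leading exponents of a right
    ideal form an up-set, to which Dickson's lemma applies. *)
Lemma raise_leading (L : R -> Prop) (A : {poly {poly K}}) j i :
    right_ideal L -> A != 0 -> L (nf A) ->
    (size A <= j)%N -> (size (lead_coef A) <= i)%N ->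
  exists B, [/\ B != 0, L (nf B), size B = j & size (lead_coef B) = i].
Proof.
move=> [_ _ LM] A_neq0 LA leAj leAi.
have [B [B_neq0 LB szB lcB]] : exists B, [/\ B != 0, L (nf B),
    size B = size A & size (lead_coef B) = i].
  rewrite -(subnK leAi); elim: (i - _)%N => [|k [B [B_neq0 LB szB lcB]]].
    by exists A.
  exists (twistH B); rewrite nf_twistH // -size_poly_eq0 size_twistH size_poly_eq0.
  by split; rewrite ?size_lead_twistH ?lcB //; apply: LM.
exists (B * 'X^(j - size A)); split.
- by rewrite mulf_neq0 // -size_poly_eq0 size_polyXn.
- by rewrite nfMXn; apply: LM.
- by rewrite size_mulXn // szB subnK.
- by rewrite lead_coefM lead_coefXn mulr1.
Qed.

Lemma right_ideal_scale (L : R -> Prop) a k : right_ideal L -> L a -> L (k *: a).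
Proof.
move=> [_ _ LM] La; have -> : k *: a = a * k%:A; last exact: LM.
by apply: I1P => p; rewrite !(I1_mul, I1_scale, I1_one) linearZ.
Qed.

(** Division algorithm for the lexicographic order on (degree in I, degree of
    the leading coefficient). *)
Lemma nf_noetherian (L : R -> Prop) : right_ideal L ->
  exists2 s : seq R, (forall b, b \in s -> L b) &
                     forall A, L (nf A) -> rspan s (nf A).
Proof.
move=> idL.
pose lead (x : nat * nat) (A : {poly {poly K}}) :=
  [/\ A != 0, L (nf A), size A = x.1 & size (lead_coef A) = x.2].
have [t tL Lt] := dickson (fun j i => exists A, lead (j, i) A).
have [f fL] : exists f, forall x, x \in t -> lead x (f x).
  suff: forall x, exists A, x \in t -> lead x A by case/choice=> f fL; exists f.
  move=> [j i].
  have [/tL[A leadA]|] := boolP ((j, i) \in t); first by exists A.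
  by exists 0.
pose s := [seq nf (f x) | x <- t].
exists s => [b /mapP[x /fL[_ Lx _ _] ->]|] //.
have ids := rspan_ideal s.
suff red n m (A : {poly {poly K}}) :
    (size A < n)%N -> (size (lead_coef A) < m)%N ->
    L (nf A) -> rspan s (nf A).
  by move=> A; apply: (red (size A).+1 (size (lead_coef A)).+1).
elim: n m A => // n IHn; elim=> // m IHm A ltAn ltAm LA.
have [->|A_neq0] := eqVneq A 0; first by rewrite raddf0; case: ids.
have [|x xt /andP[le1 le2]] := Lt (size A) (size (lead_coef A)).
  by exists A.
have [fx_neq0 _ szfx lcfx] := fL _ xt.
have [|||B [B_neq0 sB szB lcB]] :=
    raise_leading (j := size A) (i := size (lead_coef A)) ids fx_neq0.
- by apply/mem_rspan/map_f.
- by rewrite szfx.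
- by rewrite lcfx.
have LB : L (nf B).
  by apply: rspan_min sB => // b /mapP[y /fL[_ Ly _ _] ->].
(* The ratio of leading scalars: subtracting k B cancels the leading monomial. *)
pose k := lead_coef (lead_coef A) / lead_coef (lead_coef B).
have skB : rspan s (nf (k%:P *: B)) by rewrite nf_scale; apply: right_ideal_scale.
pose C := A - k%:P *: B.
have nfC : nf C = nf A - nf (k%:P *: B) by rewrite raddfB.
suff sC : rspan s (nf C).
  have [_ sD _] := ids.
  by rewrite -[nf A](subrK (nf (k%:P *: B))) -nfC; apply: sD.
have LC : L (nf C).
  by rewrite nfC; apply: ridealB => //; rewrite nf_scale; apply: right_ideal_scale.
have leCA : (size C <= size A)%N.
  rewrite (leq_trans (size_polyD _ _)) // geq_max leqnn size_polyN.
  by rewrite (leq_trans (size_scale_leq _ _)) ?szB.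
have [ltCA|leAC] := ltnP (size C) (size A).
  by apply: (IHn (size (lead_coef C)).+1) => //; apply: leq_trans ltCA _.
have szC : size C = size A by apply/eqP; rewrite eqn_leq leCA.
apply: IHm => //; first by rewrite szC.
suff ltC : (size (lead_coef C) < size (lead_coef A))%N.
  exact: leq_trans ltC _.
have -> : lead_coef C = lead_coef A - k *: lead_coef B.
  by rewrite !lead_coefE szC szB coefB coefZ mul_polyC.
by apply: size_cancel_lead; rewrite ?lead_coef_eq0.
Qed.

(** The projection 1 - I D of V onto the constants.  Right multiplication by it
    forgets everything about an operator except its value at the polynomial 1. *)
Definition corner : R := 1 - prim * diff.

Lemma cornerE p : corner p = (p`_0)%:P.
Proof.
apply/polyP => -[|n].
  by rewrite /corner I1_sub I1_mul I1_one coefB coefC coef0_prim subr0.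
rewrite /corner I1_sub I1_mul I1_one coefB coefC /= coef_prim.
by rewrite coef_deriv -[_ *+ n.+1]mulr_natr mulfK ?subrr // natK_neq0.
Qed.

Lemma eq_mul_corner (a b : R) : a 1 = b 1 -> a * corner = b * corner.
Proof.
move=> eq1; apply: I1P => p.
by rewrite !I1_mul cornerE -[_%:P]mulr1 mul_polyC !linearZ /= eq1.
Qed.

(** The values [l 1] of size at most [D] span a finite-dimensional space, and
    generators of it lift to L. *)
Lemma corner_span_small (L : R -> Prop) D : right_ideal L ->
  exists2 s : seq R, (forall b, b \in s -> L b) &
    forall l, L l -> (size (l 1%R) <= D)%N -> rspan s (l * corner).
Proof.
move=> idL; elim: D => [|D [s sL Ls]].
  exists [::] => //= l _; rewrite leqn0 size_poly_eq0 => /eqP l1.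
  by rewrite (@eq_mul_corner l 0) ?mul0r.
have [[l0 [Ll0 szl0]]|no_l] := pselect (exists l, L l /\ size (l 1) = D.+1);
  last first.
  exists s => // l Ll; rewrite leq_eqVlt => /predU1P[szl|]; last exact: Ls.
  by case: no_l; exists l.
exists (l0 :: s) => [b|l Ll]; first by rewrite inE => /predU1P[->|/sL].
rewrite leq_eqVlt => /predU1P[szl|/(Ls l Ll) sl]; last first.
  by apply: sub_rspan sl => b bs; rewrite inE bs orbT.
pose k := lead_coef (l 1) / lead_coef (l0 1).
exists (k *: corner); set l' := l - k *: l0.
have -> : l * corner - l0 * (k *: corner) = l' * corner.
  rewrite [RHS]mulrBl; congr (_ - _).
  by apply: I1P => p; rewrite !(I1_mul, I1_scale) linearZ.
apply: Ls; first by apply: ridealB => //; apply: right_ideal_scale.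
have l1_neq0 : l 1 != 0 by rewrite -size_poly_eq0 szl.
have := size_cancel_lead l1_neq0 (etrans szl (esym szl0)).
by rewrite /l' I1_sub I1_scale szl ltnS.
Qed.

(** 1 - I^m D^m is the sum of I^i (1 - I D) D^i over i < m. *)
Lemma rspan_truncation (L : R -> Prop) s : right_ideal L ->
    (forall l, L l -> rspan s (l * corner)) ->
  forall m a, L a -> rspan s (a - a * (prim ^+ m * diff ^+ m)).
Proof.
move=> [_ _ LM] sL m a La; have [s0 sD sM] := rspan_ideal s.
elim: m => [|m IHm]; first by rewrite !expr0 !mulr1 subrr.
have -> : a - a * (prim ^+ m.+1 * diff ^+ m.+1) =
    a - a * (prim ^+ m * diff ^+ m) + (a * prim ^+ m) * corner * diff ^+ m.
  rewrite exprSr exprS /corner mulrBr mulr1 mulrBl !mulrA addrA subrK //.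
by apply: sD => //; apply/sM/sL/LM.
Qed.

(** By the index formula the image of [c] contains polynomials of every large
    degree, with which the top terms of [p] can be removed. *)
Lemma fin_coker (c : R) : ~ finrank c ->
  exists D, forall p, exists q, (size (p - c q)%R <= D)%N.
Proof.
move=> /fredholm_index[N [m [J szc]]]; exists (N + J)%N => p.
have [n] := ubnP (size p); elim: n p => // n IHn p le_pn.
have [lep|ltp] := leqP (size p) (N + J); first by exists 0; rewrite raddf0 subr0.
(* This degree is the one that [c] shifts to the degree of [p]. *)
pose q0 : {poly K} := 'X^((size p + m - J).-1).
have szq0 : size q0 = (size p + m - J)%N by rewrite size_polyXn; lia.
have szcq0 : size (c q0) = size p.
  by apply/eqP; rewrite -(eqn_add2r m) szc szq0 ?subnK //; lia.
have p_neq0 : p != 0 by apply: contraTneq ltp => ->; rewrite size_poly0.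
have ltp' := size_cancel_lead p_neq0 (esym szcq0).
have [|q szq] := IHn _ (leq_trans ltp' _); first by rewrite -ltnS.
exists (lead_coef p / lead_coef (c q0) *: q0 + q).
by rewrite linearD linearZ /= opprD addrA.
Qed.

Lemma horner_mulx (q p : {poly K}) : horner_alg mulx q p = q * p.
Proof.
elim/poly_ind: q p => [|q c IHq] p; first by rewrite rmorph0 mul0r.
rewrite rmorphD rmorphM /= horner_algX horner_algC IHq.
by rewrite I1_scale I1_one mulxE mulrDl mul_polyC mulrA.
Qed.

(** Modulo the multiples of [c], the values at 1 of the elements of L have
    bounded degree, so finitely many elements of L generate all [l * corner].
    Together with generators of the normal forms in L this suffices, since
    a = a (1 - I^m D^m) + (a I^m) D^m. *)
Lemma fg_right_not_finrank (L : R -> Prop) c :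
  right_ideal L -> L c -> ~ finrank c -> fg_right L.
Proof.
move=> idL Lc /fin_coker[D coker]; have [_ _ LM] := idL.
have [s sL Ls] := corner_span_small D idL.
have [t tL Lt] := nf_noetherian idL.
pose u := c :: s ++ t; have [_ uD uM] := rspan_ideal u.
have su : {subset s <= u} by move=> b bs; rewrite inE mem_cat bs orbT.
have tu : {subset t <= u} by move=> b bt; rewrite inE mem_cat bt !orbT.
have uL b : b \in u -> L b.
  by rewrite inE mem_cat => /or3P[/eqP->|/sL|/tL].
have ucorner l : L l -> rspan u (l * corner).
  move=> Ll; have [q szq] := coker (l 1).
  pose r := c * horner_alg mulx q.
  have Lr : L r by apply: LM.
  rewrite -[l](subrK r) mulrDl; apply: uD.
    apply: (sub_rspan su); apply: Ls; first exact: ridealB.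
    by rewrite I1_sub I1_mul horner_mulx mulr1.
  by apply/uM/uM/mem_rspan/mem_head.
apply: (fg_rightI idL uL) => a La; have [m [A eqA]] := normal_formP a.
rewrite -[a](subrK (a * (prim ^+ m * diff ^+ m))); apply: uD.
  exact: (rspan_truncation idL ucorner m La).
rewrite mulrA eqA; apply/uM/(sub_rspan tu)/Lt; rewrite -eqA; exact: LM.
Qed.

(** * The Ore condition modulo elements of finite rank *)

(** The sum of the right ideals generated by [h ^+ i * g], i < k, bracketed as in
    the Horner scheme: this exposes the factor [h] to be cancelled. *)
Fixpoint power_span (g h : R) k (a : R) : Prop :=
  if k is k'.+1 then exists r y, power_span g h k' y /\ a = g * r + h * y
  else a = 0.

Lemma power_span_ideal g h k : right_ideal (power_span g h k).
Proof.
elim: k => [|k [IH0 IHD IHM]] /=.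
  by split=> // [a b -> ->|a c ->]; rewrite ?addr0 ?mul0r.
split=> [|a b [r [y [Sy ->]]] [r' [y' [Sy' ->]]]|a c [r [y [Sy ->]]]].
- by exists 0, 0; rewrite !mulr0 addr0.
- by exists (r + r'), (y + y'); split; [exact: IHD | rewrite !mulrDr addrACA].
- by exists (r * c), (y * c); split; [exact: IHM | rewrite mulrDl !mulrA].
Qed.

Lemma power_span_mono g h k l a : (k <= l)%N ->
  power_span g h k a -> power_span g h l a.
Proof.
move=> /subnK <-; elim: (l - k)%N => // n IHn {}/IHn.
rewrite addSn; elim: (n + k)%N a => [|m IHm] a /=.
  by move->; exists 0, 0; rewrite !mulr0 addr0.
by case=> r [y [/IHm Sy ->]]; exists r, y.
Qed.

Lemma mem_power_span g h k : power_span g h k.+1 (h ^+ k * g).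
Proof.
elim: k => [|k IHk]; first by exists 1, 0; rewrite mulr0 addr0 mulr1 mul1r.
by exists 0, (h ^+ k * g); rewrite mulr0 add0r exprS mulrA.
Qed.

Lemma not_finrank_mul_primX (a : R) m :
  ~ finrank a -> ~ finrank (a * prim ^+ m).
Proof. by move=> a_inf; apply: not_finrankM => //; apply: not_finrank_primX. Qed.

(** A relation h^(k+1) g c = g r + h y is an Ore relation when [r] has infinite
    rank.  Otherwise multiplying by a power of I kills [r], and cancelling [h] up
    to a further power of I leaves a relation with [k] in place of [k + 1]. *)
Lemma ore_of_power_span (g h : R) k c : ~ finrank h -> ~ finrank c ->
    power_span g h k (h ^+ k * g * c) ->
  exists c' d, ~ finrank c' /\ g * c' = h * d.
Proof.
move=> h_inf; elim: k c => [|k IHk] c c_inf /=.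
  by rewrite expr0 mul1r => gc0; exists c, 0; rewrite gc0 mulr0.
case=> r [y [Sy eq_y]].
have eq_gr : g * r = h * (h ^+ k * g * c - y).
  by rewrite mulrBr !mulrA -exprS eq_y addrK.
have [/finrankP[m r0]|r_inf] := pselect (finrank r); last first.
  by exists r, (h ^+ k * g * c - y).
pose z := (h ^+ k * g * c - y) * prim ^+ m.
have hz0 : h * z = 0 by rewrite mulrA -eq_gr -mulrA r0 mulr0.
have [/finrankP[n z0]|z_inf] := pselect (finrank z); last first.
  case: (not_finrankM h_inf z_inf); rewrite hz0.
  by exists 0%N => q; rewrite size_poly0.
apply: (IHk (c * prim ^+ (m + n))); first exact: not_finrank_mul_primX.
have -> : h ^+ k * g * (c * prim ^+ (m + n)) = y * prim ^+ (m + n).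
  by apply/eqP; rewrite mulrA -subr_eq0 -mulrBl exprD mulrA; apply/eqP.
by have [_ _ SM] := power_span_ideal g h k; apply: SM.
Qed.

(** The right ideal generated by all the [h ^+ k * g] contains [g], hence is
    finitely generated; so some [h ^+ k * g] depends on the previous ones. *)
Lemma ore_condition (g h : R) : ~ finrank g -> ~ finrank h ->
  exists c d, ~ finrank c /\ g * c = h * d.
Proof.
move=> g_inf h_inf; pose L a := exists k, power_span g h k a.
have idL : right_ideal L.
  split=> [|a b [k Sa] [l Sb]|a c [k Sa]]; first by exists 0%N.
    have [_ SD _] := power_span_ideal g h (k + l).
    exists (k + l)%N.
    by apply: SD; [apply: power_span_mono Sa | apply: power_span_mono Sb]; lia.
  by have [_ _ SM] := power_span_ideal g h k; exists k; apply: SM.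
have Lg : L g.
  by exists 1%N; have := mem_power_span g h 0; rewrite expr0 mul1r.
have [s Ls] := fg_right_not_finrank idL Lg g_inf.
have [k sk] : exists k, forall b, b \in s -> power_span g h k b.
  have sL b : b \in s -> L b by move=> bs; apply/Ls/mem_rspan.
  elim: s sL {Ls} => [|b s IHs] sL; first by exists 0%N.
  have [k Sb] := sL b (mem_head b s).
  have [c cs|l Ss] := IHs; first by apply: sL; rewrite inE cs orbT.
  exists (k + l)%N => c; rewrite inE => /predU1P[->|/Ss].
    by apply: power_span_mono Sb; lia.
  by apply: power_span_mono; lia.
apply: (@ore_of_power_span g h k 1) => //.
  exact: (not_finrank_primX (m := 0)).
rewrite mulr1; apply: rspan_min (power_span_ideal g h k) sk _; apply/Ls.
by exists k.+1; apply: mem_power_span.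
Qed.

(** * Quotients of right ideals *)

Lemma rspan_image_bounded (s : seq R) : (forall b, b \in s -> finrank b) ->
  exists B, forall a, rspan s a -> forall q : {poly K}, (size (a q) <= B)%N.
Proof.
elim: s => [|b s IHs] sF.
  by exists 0%N => a /= -> q; rewrite size_poly0.
have [C leC] := sF b (mem_head b s).
have [c cs|B leB] := IHs; first by apply: sF; rewrite inE cs orbT.
exists (maxn B C) => a /= [c /leB leac] q; rewrite -[a](subrK (b * c)) I1_add.
by rewrite (leq_trans (size_polyD _ _)) // geq_max !leq_max leac leC orbT.
Qed.

(** If (J : g) is not already covered by [fg_right_not_finrank], then J has only
    elements of finite rank, with a common bound on their images, and [g] has
    infinite rank, so that it reflects boundedness of degrees: the values at 1
    on (J : g) are bounded, and all its elements have finite rank. *)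
Lemma fg_right_colon (J : R -> Prop) g : right_ideal J -> fg_right J ->
  fg_right (fun a => J (g * a)).
Proof.
move=> idJ [s sJ]; have [J0 JD JM] := idJ; set L := fun a => J (g * a).
have idL : right_ideal L.
  split=> [|a b La Lb|a c La]; first by rewrite /L mulr0.
    by rewrite /L mulrDr; apply: JD.
  by rewrite /L mulrA; apply: JM.
have [/finrankP[m g0]|g_inf] := pselect (finrank g).
  apply: (fg_right_not_finrank (c := prim ^+ m) idL).
    by rewrite /L g0.
  exact: not_finrank_primX.
have [[h [Jh h_inf]]|J_fin] := pselect (exists h, J h /\ ~ finrank h).
  have [c [d [c_inf eq_gc]]] := ore_condition g_inf h_inf.
  by apply: (fg_right_not_finrank idL _ c_inf); rewrite /L eq_gc; apply: JM.
have finJ a : J a -> finrank a.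
  by move=> Ja; apply: contrapT => a_inf; apply: J_fin; exists a.
have [B leB] : exists B, forall a, J a ->
    forall q : {poly K}, (size (a q) <= B)%N.
  have [b bs|B leB] := @rspan_image_bounded s; first exact/finJ/sJ/mem_rspan.
  by exists B => a /sJ/leB.
have [N [m [j szg]]] := fredholm_index g_inf.
have [t tL Lt] := corner_span_small (N + B + m) idL.
apply: (fg_rightI idL tL) => l Ll.
have finl : finrank l.
  apply: contrapT => l_inf; exact: (not_finrankM g_inf l_inf (finJ _ Ll)).
have tcorner l' : L l' -> rspan t (l' * corner).
  move=> Ll'; apply: Lt => //; rewrite leqNgt; apply/negP => lt_l'.
  have le_gB : (size (g (l' 1%R)) <= B)%N by rewrite -I1_mul; apply: leB.
  by have := szg (l' 1); move: le_gB lt_l'; lia.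
have [/(_ finl)[n l0] _] := finrankP l.
have := rspan_truncation idL tcorner n Ll.
by rewrite mulrA l0 mul0r subr0.
Qed.

(** * The adjoint anti-automorphism *)

(** The symmetric form making the divided powers x^i / i! orthonormal.  In that
    basis D and I are the two opposite shifts and H is diagonal. *)
Definition pairing (p q : {poly K}) : K :=
  \sum_(i < size p) (i`!%:R ^+ 2) * (p`_i * q`_i).

Lemma pairingE N p q : (size p <= N)%N ->
  pairing p q = \sum_(i < N) (i`!%:R ^+ 2) * (p`_i * q`_i).
Proof.
move=> leN; rewrite /pairing.
rewrite (big_ord_widen N (fun i => i`!%:R ^+ 2 * (p`_i * q`_i))) //.
rewrite big_mkcond; apply: eq_bigr => i _; case: ltnP => // le_i.
by rewrite [p`_i]nth_default // mul0r mulr0.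
Qed.

Lemma pairingC p q : pairing p q = pairing q p.
Proof.
rewrite (@pairingE (maxn (size p) (size q)) p) ?leq_maxl //.
rewrite (@pairingE (maxn (size p) (size q)) q) ?leq_maxr //.
by apply: eq_bigr => i _; rewrite [p`_i * _]mulrC.
Qed.

Lemma pairing_linearr p k q r :
  pairing p (k *: q + r) = k * pairing p q + pairing p r.
Proof.
rewrite /pairing mulr_sumr -big_split; apply: eq_bigr => i _ /=.
by rewrite coefD coefZ; ring.
Qed.

Lemma pairingXn p n : pairing p 'X^n = n`!%:R ^+ 2 * p`_n.
Proof.
rewrite (@pairingE (maxn (size p) n.+1)) ?leq_maxl //.
have lt_n : (n < maxn (size p) n.+1)%N by rewrite leq_max ltnSn orbT.
rewrite (bigD1 (Ordinal lt_n)) //= coefXn eqxx mulr1 big1 ?addr0 // => i.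
by rewrite -val_eqE coefXn /= => /negPf->; rewrite !mulr0.
Qed.

Lemma pairing_inj p q : (forall r, pairing p r = pairing q r) -> p = q.
Proof.
move=> eq_pq; apply/polyP => n; have := eq_pq 'X^n; rewrite !pairingXn.
apply: mulfI; rewrite expf_neq0 //.
by rewrite -(prednK (fact_gt0 n)) natK_neq0.
Qed.

Lemma pairing_prim p q : pairing (prim p) q = pairing p (diff q).
Proof.
rewrite (@pairingE (size p).+1 (prim p)); last first.
  by apply/leq_sizeP => -[|j] //= lt_j; rewrite coef_prim nth_default ?mul0r.
rewrite big_ord_recl coef0_prim mul0r mulr0 add0r; apply: eq_bigr => i _.
rewrite coef_prim diffE coef_deriv factS natrM -[q`__ *+ _]mulr_natr lift0.
by have := natK_neq0 i; move: (i.+1%:R : K) => k k_neq0; field.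
Qed.

(** As x = I H, its adjoint is H D = D x D. *)
Lemma pairing_mulx p q : pairing (diff (mulx (diff p))) q = pairing p (mulx q).
Proof.
rewrite (@pairingE (size p)); last first.
  apply/leq_sizeP => j le_j; rewrite coef_deriv coefXM coef_deriv /=.
  by rewrite nth_default ?mul0rn ?leqW.
rewrite (@pairingE (size p).+1 p) ?leqnSn // big_ord_recl mulxE coefXM.
rewrite !mulr0 add0r.
apply: eq_bigr => i _; rewrite coefXM coef_deriv coefXM coef_deriv /=.
by rewrite factS natrM -[p`_i.+1 *+ _]mulr_natr -[(_ * _) *+ _]mulr_natr; ring.
Qed.

Lemma adjoint_exists (a : R) :
  exists b : R, forall p q, pairing (b p) q = pairing p (a q).
Proof.
elim/I1_ind: a => [|k a a' [b bP] [b' b'P]|a a' [b bP] [b' b'P]|||].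
- by exists 1.
- exists (k *: b + b') => p q.
  rewrite I1_add I1_scale pairing_linearr -bP -b'P ![pairing _ q]pairingC.
  by rewrite pairing_linearr.
- by exists (b' * b) => p q; rewrite !I1_mul b'P bP.
- by exists (diff * mulx * diff) => p q; apply: pairing_mulx.
- by exists prim => p q; apply: pairing_prim.
- by exists diff => p q; rewrite pairingC -pairing_prim pairingC.
Qed.

Definition star (a : R) : R := sval (cid (adjoint_exists a)).

Lemma starP a p q : pairing (star a p) q = pairing p (a q).
Proof. by rewrite /star; case: cid. Qed.

Lemma adjoint_uniq (a b : R) :
  (forall p q, pairing (a p) q = pairing (b p) q) -> a = b.
Proof. by move=> eq_ab; apply: I1P => p; apply: pairing_inj. Qed.

Lemma starK : involutive star.
Proof.
by move=> a; apply: adjoint_uniq => p q; rewrite starP pairingC starP pairingC.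
Qed.

Lemma starM a b : star (a * b) = star b * star a.
Proof. by apply: adjoint_uniq => p q; rewrite starP !I1_mul !starP. Qed.

Fact star_additive : zmod_morphism star.
Proof.
move=> a b; apply: adjoint_uniq => p q; rewrite starP !I1_sub.
have pairingB (r s t : {poly K}) :
    pairing r (s - t) = pairing r s - pairing r t.
  by rewrite addrC -scaleN1r pairing_linearr mulN1r addrC.
by rewrite pairingB [RHS]pairingC pairingB ![pairing q _]pairingC !starP.
Qed.
HB.instance Definition _ := GRing.isZmodMorphism.Build R R star star_additive.

Lemma I1_right_syzygies : right_syzygies_fg R.
Proof. exact: right_syzygies_of_colon fg_right_colon. Qed.

Lemma I1_left_syzygies : left_syzygies_fg R.
Proof.
exact: (left_syzygies_anti (phi := star) starM starK starK I1_right_syzygies).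
Qed.

End IntegroDifferential.

Theorem theorem4p4 (K : fieldType) (charK0 : [pchar K]%R =i pred0) :
  left_coherent (I1 K) /\ right_coherent (I1 K).
Proof.
split; first exact/left_coherent_syzygies/I1_left_syzygies.
exact/right_coherent_syzygies/I1_right_syzygies.
Qed.
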